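(* Let $d\geq 1$, let $w,w'\in\{0,1\}^d$, and let $f:\mathbb{R}_w\to\mathbb{R}$ be a Lebesgue measurable componentwise subadditive function. 1. If $w$ contains evenly many 1s, then the following limit exists, with $$\lim_{(x_1,\ldots,x_d)\to\mathcal{R}_w}\frac{f(x_1,\ldots,x_d)}{x_1\cdots x_d}=\inf_{(x_1,\ldots,x_d)\in\mathbb{R}_w}\frac{f(x_1,\ldots,x_d)}{x_1\cdots x_d},$$ and this value is not $+\infty$, but can be $-\infty$. 2. If $w$ contains oddly many 1s, then the following limit exists, with $$\lim_{(x_1,\ldots,x_d)\to\mathcal{R}_w}\frac{f(x_1,\ldots,x_d)}{x_1\cdots x_d}=\sup_{(x_1,\ldots,x_d)\in\mathbb{R}_w}\frac{f(x_1,\ldots,x_d)}{x_1\cdots x_d},$$ and this value is not $-\infty$, but can be $+\infty$. 3. Suppose now that $w$ contains evenly many 1s, that $w'$ differs from $w$ in exactly one coordinate, say the $i$-th, and that $f$ is defined (real-valued, Lebesgue measurable) and componentwise subadditive in $\mathbb{R}_w\cup\mathbb{R}_{w'}\cup U_{w,w'}$, where $$U_{w,w'}=\{x\in\mathbb{R}^d\mid x_i=0,\ (x_1,\ldots,x_{i-1},1,x_{i+1},\ldots,x_d)\in\mathbb{R}_w\cup\mathbb{R}_{w'}\}$$ is the boundary between $\mathbb{R}_w$ and $\mathbb{R}_{w'}$. Then $$\lim_{(x_1,\ldots,x_d)\to\mathcal{R}_{w'}}\frac{f(x_1,\ldots,x_d)}{x_1\cdots x_d}\leq\lim_{(x_1,\ldots,x_d)\to\mathcal{R}_w}\frac{f(x_1,\ldots,x_d)}{x_1\cdots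 x_d};$$ consequently, both limits are finite.
   Context: $\mathbb{R}_+$ and $\mathbb{R}_-$ are the sets of positive and negative real numbers (zero excluded), considered as additive semigroups. For $w=w_1\ldots w_d\in\{0,1\}^d$, $\mathbb{R}_w=\prod_{j=1}^d X_j\subseteq\mathbb{R}^d$, where $X_j=\mathbb{R}_+$ if $w_j=0$ and $X_j=\mathbb{R}_-$ if $w_j=1$. The orthant $\mathcal{R}_w$ is the set $\mathbb{R}_w$ directed by the product order of $(X_j,\leq_j)$, where $\leq_j$ is the usual order $\leq$ if $w_j=0$ and the reversed order $\geq$ if $w_j=1$; that is, $x$ precedes $y$ iff $|x_j|\leq|y_j|$ for every $j$. For a function $g$ on a directed set $\mathcal{U}=(U,\preceq)$, $\liminf_{x\to\mathcal{U}}g(x)=\sup_{x\in U}\inf_{y\succeq x}g(y)$ and $\limsup_{x\to\mathcal{U}}g(x)=\inf_{x\in U}\sup_{y\succeq x}g(y)$; the limit $\lim_{x\to\mathcal{U}}g(x)$ is their common value (possibly infinite) when they coincide. A function $g$ on an additive semigroup $S$ is subadditive if $g(x+y)\leq g(x)+g(y)$ for all $x,y\in S$. A function $f$ on a product $S_1\times\cdots\times S_d$ of semigroups is componentwise subadditive if, for every $i$ and every fixed choice of $x_j\in S_j$ for all $j\neq i$, the function $x_i\mapsto f(x_1,\ldots,x_i,\ldots,x_d)$ is subadditive on $S_i$. The set $\mathbb{R}_w\cup\mathbb{R}_{w'}\cup U_{w,w'}$ in part 3 is the product of semigroups whose $i$-th factor is $\mathbb{R}$ and whose $j$-th factor, for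 $j\neq i$, is $\mathbb{R}_+$ or $\mathbb{R}_-$ according to $w_j=0$ or $w_j=1$. *)

(* Defs.v *)
From HB Require Import structures.
From mathcomp Require Import all_boot all_order all_algebra.
From mathcomp Require Import all_classical all_reals all_analysis.

Set Implicit Arguments.
Unset Strict Implicit.
Unset Printing Implicit Defensive.
Import Order.TTheory GRing.Theory Num.Theory.
Import numFieldNormedType.Exports.

Local Open Scope classical_set_scope.
Local Open Scope ring_scope.

(* Lebesgue outer measure on R^d: infimum of the total volume over the
   countable covers by closed boxes, a box being encoded by its pair of
   opposite corners. The library has no n-dimensional Lebesgue measure. *)
Section lebesgue_outer.
Context (R : realType) (d : nat).

Definition cbox (ab : 'rV[R]_d * 'rV[R]_d) : set 'rV[R]_d :=
  [set x | forall j, ab.1 ord0 j <= x ord0 j <= ab.2 ord0 j].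

(* The truncation makes the volume 0 when the corners are in the wrong order,
   i.e. when the box is empty. *)
Definition cbox_vol (ab : 'rV[R]_d * 'rV[R]_d) : R :=
  \prod_(j < d) Num.max 0 (ab.2 ord0 j - ab.1 ord0 j).

Definition cbox_cover (A : set 'rV[R]_d) : set (set ('rV[R]_d * 'rV[R]_d)) :=
  [set K | countable K /\ A `<=` \bigcup_(ab in K) cbox ab].

Definition lebesgue_outer (A : set 'rV[R]_d) : \bar R :=
  ereal_inf [set \esum_(ab in K) (cbox_vol ab)%:E | K in cbox_cover A].

Local Open Scope ereal_scope.

Lemma cbox_vol_ge0 ab : 0 <= (cbox_vol ab)%:E.
Proof. by rewrite lee_fin; apply: prodr_ge0 => j _; rewrite le_max lexx. Qed.

Lemma lebesgue_outer_ge0 A : 0 <= lebesgue_outer A.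
Proof.
apply: le_ereal_inf_tmp => x [K _ <-{x}].
by apply: esum_ge0 => ab _; exact: cbox_vol_ge0.
Qed.

Lemma lebesgue_outer0 : lebesgue_outer set0 = 0.
Proof.
apply/eqP; rewrite eq_le lebesgue_outer_ge0 andbT.
apply: ereal_inf_lbound; exists set0; last by rewrite esum_set0.
by split.
Qed.

Lemma le_lebesgue_outer : {homo lebesgue_outer : A B / A `<=` B >-> A <= B}.
Proof.
move=> A B AB; apply: ereal_inf_le_tmp => x [K [cK BK] <-{x}].
by exists K => //; split => //; exact: subset_trans BK.
Qed.

Lemma lebesgue_outer_sigma_subadditive : sigma_subadditive lebesgue_outer.
Proof.
move=> A; have [[i ioo]|] := pselect (exists i, lebesgue_outer (A i) = +oo).
  rewrite (eseries_pinfty _ _ ioo) ?leey// => n _.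
  by rewrite -ltNye (lt_le_trans _ (lebesgue_outer_ge0 _)).
rewrite -forallNE => Aoo.
suff add2e (e : {posnum R}) : lebesgue_outer (\bigcup_n A n) <=
    \sum_(i <oo) lebesgue_outer (A i) + e%:num%:E.
  by apply/lee_addgt0Pr => _/posnumP[].
rewrite (le_trans _ (epsilon_trick _ _ _))//; last first.
  by move=> n; exact: lebesgue_outer_ge0.
pose P n K := cbox_cover (A n) K /\ \esum_(ab in K) (cbox_vol ab)%:E <=
  lebesgue_outer (A n) + (e%:num / (2 ^ n.+1)%:R)%:E.
have [K PK] : {K : nat -> _ & forall n, P n (K n)}.
  apply: (@choice _ _ P) => n; rewrite /P.
  have fA : lebesgue_outer (A n) \is a fin_num.
    rewrite ge0_fin_numE ?lebesgue_outer_ge0// ltey.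
    by apply/eqP => /(Aoo n).
  have e0 : (0 < e%:num / (2 ^ n.+1)%:R :> R)%R by [].
  have [_ [K cK <-] /ltW] := lb_ereal_inf_adherent e0 fA.
  by exists K.
apply: (@le_trans _ _ (\esum_(ab in \bigcup_n K n) (cbox_vol ab)%:E)).
  apply: ereal_inf_lbound; exists (\bigcup_n K n) => //; split.
    by apply: bigcup_countable => // n _; case: (PK n) => -[].
  move=> x [n _ Anx]; have [[_ /(_ _ Anx)[ab Kab xab]] _] := PK n.
  by exists ab => //; exists n.
rewrite seqDU_bigcup_eq esum_bigcupT; last 2 first.
- exact: trivIset_seqDU.
- exact: cbox_vol_ge0.
rewrite -nneseries_esumT; last first.
  by move=> n; apply: esum_ge0 => ab _; exact: cbox_vol_ge0.
apply: lee_nneseries => [n _ _|n _].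
  by apply: esum_ge0 => ab _; exact: cbox_vol_ge0.
apply: le_trans (PK n).2.
rewrite esum_mkcond [leRHS]esum_mkcond; apply: le_esum => ab _.
case: ifPn => [/set_mem[Kn _]|_]; first by rewrite mem_set.
by case: ifPn => // _; exact: cbox_vol_ge0.
Qed.

HB.instance Definition _ := isOuterMeasure.Build R 'rV[R]_d lebesgue_outer
  lebesgue_outer0 lebesgue_outer_ge0 le_lebesgue_outer
  lebesgue_outer_sigma_subadditive.

End lebesgue_outer.

(* The source carries the Lebesgue sigma-algebra (the Caratheodory-measurable
   sets), the target the Borel one. *)
Definition lebesgue_measurable_fun (R : realType) (d : nat)
    (D : set 'rV[R]_d) (f : 'rV[R]_d -> R) : Prop :=
  measurable_fun (D : set (caratheodory_type (@lebesgue_outer R d))) f.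

Definition subadditive_on (R : realType) (S : set R) (g : R -> R) : Prop :=
  forall s t, S s -> S t -> g (s + t) <= g s + g t.

Section product_of_semigroups.
Context (R : realType) (d : nat).

Definition prodset (S : 'I_d -> set R) : set 'rV[R]_d :=
  [set x : 'rV[R]_d | forall j, S j (x ord0 j)].

Definition subst_coord (x : 'rV[R]_d) (i : 'I_d) (t : R) : 'rV[R]_d :=
  \row_j (if j == i then t else x ord0 j).

(* The i-th coordinate of x plays no role in the conclusion. *)
Definition componentwise_subadditive (S : 'I_d -> set R)
    (f : 'rV[R]_d -> R) : Prop :=
  forall (i : 'I_d) (x : 'rV[R]_d), (forall j, j != i -> S j (x ord0 j)) ->
    subadditive_on (S i) (fun t => f (subst_coord x i t)).

End product_of_semigroups.

Section orthants.
Context (R : realType) (d : nat).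
Implicit Types w : d.-tuple bool.

Definition ones w : nat := count id w.

Definition half_line (b : bool) : set R :=
  if b then [set t | t < 0] else [set t | 0 < t].

Definition orthant_factor w (j : 'I_d) : set R := half_line (tnth w j).

Definition orthant w : set 'rV[R]_d := prodset (orthant_factor w).

Definition orthant_prec w (x y : 'rV[R]_d) : Prop :=
  forall j, if tnth w j then y ord0 j <= x ord0 j else x ord0 j <= y ord0 j.

Definition differ_exactly_at w w' (i : 'I_d) : Prop :=
  tnth w' i != tnth w i /\ forall j, j != i -> tnth w' j = tnth w j.

Definition orthant_boundary w w' (i : 'I_d) : set 'rV[R]_d :=
  [set x : 'rV[R]_d | x ord0 i = 0 /\
           (orthant w `|` orthant w') (subst_coord x i 1)].

Definition glued_orthants w w' (i : 'I_d) : set 'rV[R]_d :=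
  orthant w `|` orthant w' `|` orthant_boundary w w' i.

Definition glued_factor w (i j : 'I_d) : set R :=
  if j == i then setT else orthant_factor w j.

Lemma glued_orthantsE w w' i : differ_exactly_at w w' i ->
  glued_orthants w w' i = prodset (glued_factor w i).
Proof.
move=> [wi wj]; apply/seteqP; split=> x.
- case=> [[]xw|[xi xw]] j; rewrite /glued_factor; have [//|ji] := eqVneq j i.
  + exact: (xw j).
  + by have := xw j; rewrite /orthant_factor wj.
  + by case: xw => /(_ j); rewrite /= mxE (negbTE ji) // /orthant_factor wj.
- move=> xw.
  have xwj j : j != i -> orthant_factor w j (x ord0 j).
    by move=> ji; have := xw j; rewrite /glued_factor (negbTE ji).
  have inO v : (forall j, j != i -> tnth v j = tnth w j) ->
      forall y : 'rV[R]_d, (forall j, j != i -> y ord0 j = x ord0 j) ->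
      half_line (tnth v i) (y ord0 i) -> orthant v y.
    move=> vw y yx yi j; rewrite /orthant_factor.
    by have [->//|ji] := eqVneq j i; rewrite vw// yx//; exact: xwj.
  have inOU (y : 'rV[R]_d) : (forall j, j != i -> y ord0 j = x ord0 j) ->
      y ord0 i != 0 -> (orthant w `|` orthant w') y.
    move=> yx; rewrite neq_lt => yi.
    have: half_line (tnth w i) (y ord0 i) \/ half_line (tnth w' i) (y ord0 i).
      by case: (tnth w i) (tnth w' i) wi yi => -[]//= _ /orP[]; [left|right|right|left].
    by case=> h; [left|right]; apply: inO.
  have [xi|xi] := eqVneq (x ord0 i) 0; last by left; exact: inOU.
  right; split=> //; apply: inOU => [j ji|]; rewrite mxE ?eqxx ?oner_eq0//.
  by rewrite (negbTE ji).
Qed.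

Definition normalized (f : 'rV[R]_d -> R) (x : 'rV[R]_d) : \bar R :=
  (f x / \prod_(j < d) x ord0 j)%:E.

End orthants.

Section directed_limits.
Context (R : realType) (T : Type).
Variables (U : set T) (prec : T -> T -> Prop).
Implicit Type g : T -> \bar R.

Definition dir_liminf g : \bar R :=
  ereal_sup [set ereal_inf [set g y | y in U `&` prec x] | x in U].

Definition dir_limsup g : \bar R :=
  ereal_inf [set ereal_sup [set g y | y in U `&` prec x] | x in U].

Definition has_dir_lim g (l : \bar R) : Prop :=
  dir_liminf g = l /\ dir_limsup g = l.

End directed_limits.

Definition orthant_lim (R : realType) (d : nat) (w : d.-tuple bool)
    (g : 'rV[R]_d -> \bar R) (l : \bar R) : Prop :=
  has_dir_lim (orthant w) (orthant_prec w) g l.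

(* Main.v *)
Require Import Defs.
From HB Require Import structures.
From mathcomp Require Import all_boot all_order all_algebra.
From mathcomp Require Import all_classical all_reals all_analysis.
From mathcomp Require Import measurable_realfun ring lra.
Import Order.TTheory GRing.Theory Num.Theory.
Import numFieldNormedType.Exports.
Local Open Scope classical_set_scope.
Local Open Scope ring_scope.

(** The theorem is a multidimensional Fekete lemma, and its proof has three
    ingredients.

    Splitting a grid.  If x_j = n_j u_j + v_j in every coordinate, subadditivity
    used one coordinate after the other bounds f(x) by a sum over the corners
    z with z_j in {u_j, v_j}, where the corner u has weight prod n_j and the
    others have total weight prod (n_j + 1) - prod n_j
    ([componentwise_subadditive_grid]).

    Boundedness.  Measurability is used only to bound f from above on the set of
    the x that lie between two points of the orthant
    ([componentwise_subadditive_bounded]).  Splitting x = y + (x - y) in every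
    coordinate shows that if f(x) > 2^d n then, for each y between 0 and x, some
    mixture of y and x - y satisfies f >= n.  A mixture is the image of y under a
    reflection of some coordinates, which preserves Lebesgue measure, so the set
    where f >= n keeps at least a 1/2^d share of the volume of the box between 0
    and x.  That set shrinks to the empty set as n grows, and its volume tends
    to 0.  Three facts on the outer measure defined by boxes carry this: the
    coordinates are Caratheodory-measurable ([measurable_coord]), boxes have
    positive outer measure ([lebesgue_outer_prodset_ge]), and reflections do not
    increase the outer measure ([lebesgue_outer_reflect]).

    Fekete.  Given u in the orthant and x far away, take n_j so that the remainder
    v_j = x_j - n_j u_j lies between u_j and 2 u_j.  All corners are then between
    u and 2u, where f is bounded, and the grid bound divided by prod |x_j| tends
    to f(u) / prod |u_j| ([fekete_orthant]).  Hence f(x) / prod |x_j| converges to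
    its infimum.  The sign of prod x_j on the orthant is (-1)^(number of ones),
    so this is the statement for even w, and its negation is the one for odd w.
    The function - prod x_j^2 has an infinite limit in both cases.

    For adjacent orthants, f(x|x_i=0) <= 2 f(x|x_i=0) gives f(x|x_i=0) >= 0, so
    f(x) + f(x') >= 0 when x' is x with its i-th coordinate negated.  As prod x'
    is - prod x < 0, the quotient at x' is at most the quotient at x; the mirror
    x |-> x' preserves going to infinity, so the limits compare in the same way.
    One limit is not +oo and the other is not -oo, hence both are finite. *)

(** * Splitting a grid *)

Lemma subadditive_on_mulrn (R : realType) (S : set R) (g : R -> R)
    (S_add : forall s t, S s -> S t -> S (s + t)) (sg : subadditive_on S g)
    (u v : R) (n : nat) :
  S u -> S v -> S (u *+ n + v) /\ g (u *+ n + v) <= g u *+ n + g v.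
Proof.
move=> Su Sv; elim: n => [|n [IHS IHg]]; first by rewrite !mulr0n !add0r.
rewrite !mulrS -!addrA; split; first exact: S_add.
by apply: le_trans (sg _ _ Su IHS) _; rewrite lerD2l.
Qed.

(** The only way in which subadditivity enters the limit theorem.  The
    coordinates are split one at a time, so the induction is on the list [s] of
    the coordinates that are still unsplit; [M] absorbs every corner that uses
    [v] at least once. *)
Lemma componentwise_subadditive_grid (R : realType) (d : nat)
    (S : 'I_d -> set R) (f : 'rV[R]_d -> R)
    (S_add : forall j s t, S j s -> S j t -> S j (s + t))
    (sf : componentwise_subadditive S f)
    (u v : 'rV[R]_d) (n : 'I_d -> nat) (M : R) :
  prodset S u -> prodset S v ->
  (forall z : 'rV[R]_d,
    (forall j, z ord0 j = u ord0 j \/ z ord0 j = v ord0 j) -> f z <= M) ->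
  f (\row_j (u ord0 j *+ n j + v ord0 j)) <=
    f u * \prod_j (n j)%:R + M * (\prod_j (n j).+1%:R - \prod_j (n j)%:R).
Proof.
move=> Su Sv fM.
have Sn j : S j (u ord0 j *+ n j + v ord0 j).
  have s0 : subadditive_on (S j) (fun=> 0) by move=> ? ? _ _; rewrite addr0.
  by have [] := subadditive_on_mulrn _ _ _ (S_add j) s0 _ _ (n j) (Su j) (Sv j).
(* The best corner above z: its unsplit coordinates are all set to u. *)
pose on_u (s : seq 'I_d) (z : 'rV[R]_d) : 'rV[R]_d :=
  \row_j (if j \in s then u ord0 j else z ord0 j).
suff grid s : uniq s -> forall z : 'rV[R]_d,
    (forall j, j \notin s -> z ord0 j = u ord0 j \/ z ord0 j = v ord0 j) ->
    (forall j, j \in s -> z ord0 j = u ord0 j *+ n j + v ord0 j) ->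
    f z <= f (on_u s z) * \prod_(j <- s) (n j)%:R +
      M * (\prod_(j <- s) (n j).+1%:R - \prod_(j <- s) (n j)%:R).
  have := grid (index_enum _) (index_enum_uniq _)
    (\row_j (u ord0 j *+ n j + v ord0 j)).
  set x := (X in on_u _ X); have -> : on_u (index_enum _) x = u.
    by apply/rowP => j; rewrite mxE mem_index_enum.
  by apply=> [j|j _]; [rewrite mem_index_enum|rewrite mxE].
elim: s => [_ z _ _|j s IHs /= /andP[js us] z zuv zn].
  by rewrite !big_nil subrr mulr0 addr0 mulr1 (_ : on_u [::] z = z)//;
     apply/rowP => j; rewrite mxE.
have Sz k : k != j -> S k (z ord0 k).
  move=> kj; have [ks|ks] := boolP (k \in s).
    by rewrite zn// inE ks orbT.
  by have [| -> | ->] := zuv k => //; rewrite inE negb_or kj.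
have [_] := subadditive_on_mulrn _ _ _ (S_add j) (sf j z Sz) _ _ (n j)
  (Su j) (Sv j).
rewrite -zn ?mem_head//; have -> : subst_coord z j (z ord0 j) = z.
  by apply/rowP => k; rewrite mxE; case: eqP => [->|].
move=> /le_trans; apply.
have [IHu IHv] : (f (subst_coord z j (u ord0 j)) <=
    f (on_u (j :: s) z) * \prod_(j <- s) (n j)%:R +
      M * (\prod_(j <- s) (n j).+1%:R - \prod_(j <- s) (n j)%:R)) /\
    (f (subst_coord z j (v ord0 j)) <= M * \prod_(j <- s) (n j).+1%:R).
  have side t : t = u ord0 j \/ t = v ord0 j ->
      f (subst_coord z j t) <=
    f (on_u s (subst_coord z j t)) * \prod_(j <- s) (n j)%:R +
      M * (\prod_(j <- s) (n j).+1%:R - \prod_(j <- s) (n j)%:R).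
    move=> tuv; apply: (IHs us) => k ks; rewrite !mxE.
      case: eqP => [->//|/eqP kj]; apply: zuv.
      by rewrite inE negb_or kj.
    case: eqP => [kj|/eqP kj]; first by rewrite -kj ks in js.
    by apply: zn; rewrite inE ks orbT.
  split.
    have := side _ (or_introl erefl).
    congr (_ <= f _ * _ + _); apply/rowP => k; rewrite !mxE inE.
    by case: eqP => [->|//]; rewrite (negbTE js).
  apply: le_trans (side _ (or_intror erefl)) _.
  rewrite mulrBr addrCA gerDl subr_le0 ler_wpM2r ?prodr_ge0//.
  apply: fM => k; rewrite !mxE; case: ifPn => [_|ks]; first by left.
  by case: eqP => [->|/eqP kj]; [right|apply: zuv; rewrite inE negb_or kj].
rewrite !big_cons -[X in X + _ <= _]mulr_natl.
have n0 : 0 <= (n j)%:R :> R by [].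
apply: le_trans (lerD (ler_wpM2l n0 IHu) IHv) _.
rewrite le_eqVlt; apply/orP; left; apply/eqP.
rewrite -natr1; ring.
Qed.

(** * Lebesgue outer measure: covers and measurable sets *)

(** Sequences of boxes are easier to transform and to sum than countable sets of
    boxes.  The unused indices receive an empty box, which has volume 0 because
    there is at least one coordinate. *)
Lemma box_cover_seq (R : realType) (d : nat) (hd : (1 <= d)%N)
    (A : set 'rV[R]_d) (K : set ('rV[R]_d * 'rV[R]_d)) :
  cbox_cover A K ->
  exists2 g : nat -> 'rV[R]_d * 'rV[R]_d,
    A `<=` \bigcup_k cbox (g k) &
    (\sum_(k <oo) (cbox_vol (g k))%:E = \esum_(ab in K) (cbox_vol ab)%:E)%E.
Proof.
move=> [/countable_bijP[B KB] AK].
have /card_set_bijP[g0 g0_bij] := card_esym KB.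
pose g k := if k \in B then g0 k else (const_mx 1, const_mx 0).
exists g.
  move=> x /AK[ab Kab abx].
  have [_ _ /(_ _ Kab)[k Bk kab]] := g0_bij.
  by exists k => //; rewrite /g mem_set// kab.
rewrite nneseries_esumT; last by move=> k; exact: cbox_vol_ge0.
rewrite (reindex_esum _ _ _ _ g0_bij) [RHS]esum_mkcond.
apply: eq_esum => k _; rewrite /g; case: ifPn => // _.
rewrite /cbox_vol (bigD1 (Ordinal hd))//= !mxE sub0r.
by rewrite (elimT max_idPl) ?mul0r// oppr_le0.
Qed.

Lemma lebesgue_outer_le_sum (R : realType) (d : nat) (A : set 'rV[R]_d)
    (g : nat -> 'rV[R]_d * 'rV[R]_d) :
  A `<=` \bigcup_k cbox (g k) ->
  (lebesgue_outer A <= \sum_(k <oo) (cbox_vol (g k))%:E)%E.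
Proof.
move=> /(@le_lebesgue_outer R d)/le_trans; apply.
apply: le_trans (@lebesgue_outer_sigma_subadditive R d _) _.
apply: lee_nneseries => [k _ _|k _]; first exact: lebesgue_outer_ge0.
apply: ereal_inf_lbound; exists [set g k]; last first.
  by rewrite esum_set1//; exact: cbox_vol_ge0.
by split=> [|x gx]; [exact: countable1|exists (g k)].
Qed.

Lemma lebesgue_outer_ge (R : realType) (d : nat) (hd : (1 <= d)%N)
    (A : set 'rV[R]_d) (r : \bar R) :
  (forall g : nat -> 'rV[R]_d * 'rV[R]_d, A `<=` \bigcup_k cbox (g k) ->
    (r <= \sum_(k <oo) (cbox_vol (g k))%:E)%E) ->
  (r <= lebesgue_outer A)%E.
Proof.
move=> rA; apply: le_ereal_inf_tmp => _ [K AK <-].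
by have [g Ag <-] := box_cover_seq _ _ hd _ _ AK; exact: rA.
Qed.

Lemma max0_subl_split (R : realDomainType) (t a b : R) :
  Num.max 0 (b - Num.max a t) + Num.max 0 (Num.min b t - a) =
  Num.max 0 (b - a).
Proof.
  rewrite ?(maxEle, minEle); repeat (case: ifPn); rewrite -?ltNge; lra.
Qed.

(** A hyperplane cuts every box of a cover into two boxes whose volumes add up
    to the volume of the box. *)
Lemma measurable_half_space (R : realType) (d : nat) (hd : (1 <= d)%N)
    (j : 'I_d) (t : R) :
  measurable ([set x : 'rV[R]_d | t < x ord0 j] :
    set (caratheodory_type (@lebesgue_outer R d))).
Proof.
apply: le_caratheodory_measurable => /= X.
apply: lebesgue_outer_ge => // g Xg.
pose right_part (ab : 'rV[R]_d * 'rV[R]_d) :=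
  (subst_coord ab.1 j (Num.max (ab.1 ord0 j) t), ab.2).
pose left_part (ab : 'rV[R]_d * 'rV[R]_d) :=
  (ab.1, subst_coord ab.2 j (Num.min (ab.2 ord0 j) t)).
have vol_split ab :
    cbox_vol (right_part ab) + cbox_vol (left_part ab) = cbox_vol ab.
  rewrite /cbox_vol !(bigD1 (P := predT) j)//= !mxE eqxx.
  rewrite -[X in _ = X * _](max0_subl_split _ t) mulrDl.
  congr (_ * _ + _ * _); apply: eq_bigr => k kj;
    by rewrite mxE (negbTE kj).
rewrite (eq_eseriesr (g := fun k => (cbox_vol (right_part (g k)))%:E +
    (cbox_vol (left_part (g k)))%:E)%E); last first.
  by move=> k _; rewrite -EFinD vol_split.
rewrite nneseriesD => [|k _ _|k _ _]; [|exact: cbox_vol_ge0..].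
apply: leeD; apply: lebesgue_outer_le_sum => x [/Xg[k _ gx] /= xt];
  exists k => // i; move: (gx i); rewrite /= !mxE.
  by case: eqP => [->|//] /andP[ax xb]; rewrite ge_max ax xb ltW.
by case: eqP => [->|//] /andP[ax xb]; rewrite le_min ax xb leNgt; apply/negP.
Qed.

Lemma measurable_coord (R : realType) (d : nat) (hd : (1 <= d)%N)
    (j : 'I_d) (D : set (caratheodory_type (@lebesgue_outer R d))) :
  measurable_fun D (fun x : 'rV[R]_d => x ord0 j).
Proof.
apply: measurable_funTS.
apply: (measurability _ (RGenOInfty.measurableE R)).
move=> _ [_ [t ->] <-]; rewrite setTI.
rewrite (_ : _ @^-1` _ = [set x : 'rV[R]_d | t < x ord0 j]).
  exact: measurable_half_space.
by apply/seteqP; split=> x /=; rewrite in_itv/= andbT.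
Qed.

Lemma measurable_prodset (R : realType) (d : nat) (hd : (1 <= d)%N)
    (S : 'I_d -> set R) : (forall j, measurable (S j)) ->
  measurable (prodset S : set (caratheodory_type (@lebesgue_outer R d))).
Proof.
move=> mS.
rewrite (_ : prodset S = \bigcap_(j in setT)
    [set x : 'rV[R]_d | S j (x ord0 j)]); last first.
  by apply/seteqP; split=> [x Sx j _|x Sx j]; [exact: Sx|exact: Sx].
apply: fin_bigcap_measurable => //.
move=> j _; rewrite -[X in measurable X]setTI.
exact: (measurable_coord _ _ hd j setT measurableT _ (mS j)).
Qed.

(** * Lebesgue outer measure: products and reflections *)

(** Fubini one coordinate at a time replaces the usual compactness argument.
    A cover of the product satisfies 1 <= sum_k prod_j 1_{I_kj}(y_j) on the
    product, the I_kj being the sides of the k-th box; integrating over y_j in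
    [E j] turns the j-th indicator into at most the length of I_kj and the left
    side into at least [e j]. *)
Lemma lebesgue_outer_prodset_ge (R : realType) (d : nat) (hd : (1 <= d)%N)
    (E : 'I_d -> set R) (e : 'I_d -> R) :
  prodset E !=set0 -> (forall j, measurable (E j)) -> (forall j, 0 <= e j) ->
  (forall j, ((e j)%:E <= lebesgue_measure (E j))%E) ->
  ((\prod_j e j)%:E <= lebesgue_outer (prodset E))%E.
Proof.
move=> [y0 Ey0] mE e0 eE; apply: lebesgue_outer_ge => // g Eg.
pose side k j := [set` `[(g k).1 ord0 j, (g k).2 ord0 j]] : set R.
pose len k j := Num.max 0 ((g k).2 ord0 j - (g k).1 ord0 j).
pose fac (s : seq 'I_d) (y : 'rV[R]_d) k j : R :=
  if j \in s then len k j else \1_(side k j) (y ord0 j).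
have len0 k j : 0 <= len k j by rewrite le_max lexx.
have fac0 s y k j : 0 <= fac s y k j by rewrite /fac; case: ifP.
(* The inequality once the coordinates in s have been integrated out. *)
suff partial s : uniq s -> forall y, prodset E y ->
    ((\prod_(j <- s) e j)%:E <= \sum_(k <oo) (\prod_j fac s y k j)%:E)%E.
  apply: le_trans (partial (index_enum _) (index_enum_uniq _) y0 Ey0) _.
  apply: lee_nneseries => [k _ _|k _]; first by rewrite lee_fin prodr_ge0.
  rewrite lee_fin le_eqVlt; apply/orP; left; apply/eqP; apply: eq_bigr => j _.
  by rewrite /fac mem_index_enum.
elim: s => [_ y Ey|i s IHs /= /andP[is_ us] y Ey].
  have [k _ gk] := Eg _ Ey; rewrite big_nil.
  have k1 : \prod_j fac [::] y k j = 1.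
    apply: big1 => j _; rewrite /fac/= indicE mem_set//= /side/= in_itv/=.
    exact: gk.
  rewrite -[X in (X%:E <= _)%E]k1.
  apply: (@le_trans _ _ (\sum_(n < k.+1) (\prod_j fac [::] y n j)%:E)%E).
    rewrite big_ord_recr/= leeDr// sume_ge0// => n _.
    by rewrite lee_fin prodr_ge0.
  rewrite -(big_mkord xpredT (fun n => (\prod_j fac [::] y n j)%:E)).
  by apply: nneseries_lim_ge => n _; rewrite lee_fin prodr_ge0.
pose c k := \prod_(j | j != i) fac s y k j.
have c0 k : (0 <= (c k)%:E)%E by rewrite lee_fin prodr_ge0.
have slice t : E i t ->
    ((\prod_(j <- s) e j)%:E <= \sum_(k <oo) (c k)%:E * (\1_(side k i) t)%:E)%E.
  move=> Et; have Eyt : prodset E (subst_coord y i t).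
    by move=> j; rewrite mxE; case: eqP => [->|].
  apply: le_trans (IHs us _ Eyt) _; rewrite le_eqVlt; apply/orP; left; apply/eqP.
  apply: eq_eseriesr => k _; rewrite (bigD1 i)//= mulrC -EFinM; congr (_ * _)%:E.
    apply: eq_bigr => j ji; rewrite /fac; case: ifP => // _.
    by rewrite mxE (negbTE ji).
  by rewrite /fac (negbTE is_) mxE eqxx.
have m1 k : measurable_fun (E i) (fun t => (c k)%:E * (\1_(side k i) t)%:E)%E.
  apply: emeasurable_funM; first exact: measurable_cst.
  by apply/measurable_EFinP; apply: measurable_indic; exact: measurable_itv.
have h0 k t : (0 <= (c k)%:E * (\1_(side k i) t)%:E)%E.
  by apply: mule_ge0 => //; rewrite lee_fin.
have int_slice : ((\prod_(j <- s) e j)%:E * lebesgue_measure (E i) <=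
    \sum_(k <oo) \int[lebesgue_measure]_(t in E i)
      ((c k)%:E * (\1_(side k i) t)%:E))%E.
  rewrite -integral_cst; last exact: mE.
  rewrite -[leRHS](integral_nneseries lebesgue_measure (mE i) m1)//.
  apply: ge0_le_integral => //.
  - exact: mE.
  - by move=> t _; rewrite /= lee_fin prodr_ge0.
  - exact: (ge0_emeasurable_sum (P := xpredT) (fun k t _ _ => h0 k t)
      (fun k _ => m1 k)).
rewrite big_cons mulrC EFinM.
apply: le_trans (lee_wpmul2l _ (eE i)) _; first by rewrite lee_fin prodr_ge0.
apply: le_trans int_slice _.
apply: lee_nneseries => k _; first by move=> _; apply: integral_ge0 => t _;
  exact: h0.
rewrite ge0_integralZl//; last 2 first.
- exact: mE.
- by apply/measurable_EFinP; apply: measurable_indic; exact: measurable_itv.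
rewrite integral_indic; last 2 first.
- exact: mE.
- exact: measurable_itv.
have -> : (\prod_j fac (i :: s) y k j)%:E = ((c k)%:E * (len k i)%:E)%E.
  rewrite (bigD1 i)//= mulrC -EFinM {2}/fac mem_head; congr (_ * _)%:E.
  by apply: eq_bigr => j ji; rewrite /fac inE (negbTE ji).
apply: lee_wpmul2l => //.
apply: (@le_trans _ _ (lebesgue_measure (side k i))).
  apply: le_measure; rewrite ?inE; [|exact: measurable_itv|exact: subIsetl].
  by apply: measurableI; [exact: measurable_itv|exact: mE].
rewrite /side lebesgue_measure_itv/= /len; case: ifPn => ab.
  by rewrite -EFinB lee_fin le_max lexx orbT.
by rewrite lee_fin le_max lexx.
Qed.

(** The maps that produce, from y, all the mixtures of y and c - y. *)
Definition reflect_coords (R : realType) (d : nat) (b : {set 'I_d})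
    (c y : 'rV[R]_d) : 'rV[R]_d :=
  \row_j (if j \in b then c ord0 j - y ord0 j else y ord0 j).

(** The preimage of a box under a reflection is a box of the same volume. *)
Lemma lebesgue_outer_reflect (R : realType) (d : nat) (hd : (1 <= d)%N)
    (b : {set 'I_d}) (c : 'rV[R]_d) (A : set 'rV[R]_d) :
  (lebesgue_outer (reflect_coords R d b c @^-1` A) <= lebesgue_outer A)%E.
Proof.
apply: lebesgue_outer_ge => // g Ag.
pose reflect_box (ab : 'rV[R]_d * 'rV[R]_d) : 'rV[R]_d * 'rV[R]_d :=
  (\row_j (if j \in b then c ord0 j - ab.2 ord0 j else ab.1 ord0 j),
   \row_j (if j \in b then c ord0 j - ab.1 ord0 j else ab.2 ord0 j)).
have vol ab : cbox_vol (reflect_box ab) = cbox_vol ab.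
  apply: eq_bigr => j _; rewrite !mxE; case: ifP => // _; congr Num.max; ring.
rewrite -(eq_eseriesr (f := fun k => (cbox_vol (reflect_box (g k)))%:E)); last first.
  by move=> k _; rewrite vol.
apply: lebesgue_outer_le_sum => y /Ag[k _ gy]; exists k => // j.
move: (gy j); rewrite !mxE; case: ifP => // _ /andP[? ?]; apply/andP; split; lra.
Qed.

(** * Local boundedness in an orthant *)

Lemma half_line_add (R : realType) (b : bool) (s t : R) :
  half_line b s -> half_line b t -> half_line b (s + t).
Proof. by case: b => /=; lra. Qed.

Lemma measurable_half_line (R : realType) (b : bool) :
  measurable (half_line b : set R).
Proof.
case: b => /=.
  rewrite (_ : [set t | t < 0] = `]-oo, 0[%classic); first exact: measurable_itv.
  by apply/seteqP; split=> t /=; rewrite in_itv.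
rewrite (_ : [set t | 0 < t] = `]0, +oo[%classic); first exact: measurable_itv.
by apply/seteqP; split=> t /=; rewrite in_itv/= andbT.
Qed.

(** The t for which v = t + (v - t) splits v inside the half-line semigroup. *)
Definition half_segment (R : realType) (b : bool) (v : R) : set R :=
  [set t | half_line b t /\ half_line b (v - t)].

Lemma half_segmentE (R : realType) (b : bool) (v : R) :
  half_segment R b v = if b then `]v, 0[%classic else `]0, v[%classic.
Proof.
rewrite /half_segment; case: b; apply/seteqP; split=> t /=; rewrite in_itv/=.
- by case=> ? ?; apply/andP; split; lra.
- by case/andP=> ? ?; split; lra.
- by case=> ? ?; apply/andP; split; lra.
- by case/andP=> ? ?; split; lra.
Qed.

Lemma measurable_half_segment (R : realType) (b : bool) (v : R) :
  measurable (half_segment R b v).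
Proof. by rewrite half_segmentE; case: b; exact: measurable_itv. Qed.

Lemma lebesgue_measure_half_segment (R : realType) (b : bool) (v : R) :
  half_line b v -> lebesgue_measure (half_segment R b v) = `|v|%:E.
Proof.
rewrite half_segmentE; case: b => /= v0; rewrite lebesgue_measure_itv/= lte_fin v0.
  by rewrite ltr0_norm// -EFinB sub0r.
by rewrite gtr0_norm// -EFinB subr0.
Qed.

Lemma measurable_orthant (R : realType) (d : nat) (hd : (1 <= d)%N)
    (w : d.-tuple bool) :
  measurable (orthant w : set (caratheodory_type (@lebesgue_outer R d))).
Proof.
by apply: measurable_prodset => // j; exact: measurable_half_line.
Qed.

(** The y for which x = y + (x - y) splits x inside the orthant, that is, the
    open box with opposite corners 0 and x. *)
Definition orthant_box (R : realType) (d : nat) (w : d.-tuple bool)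
    (x : 'rV[R]_d) : set 'rV[R]_d :=
  prodset (fun j => half_segment R (tnth w j) (x ord0 j)).

Lemma lebesgue_outer_orthant_box_lty (R : realType) (d : nat)
    (w : d.-tuple bool) (x : 'rV[R]_d) :
  (lebesgue_outer (orthant_box R d w x) < +oo)%E.
Proof.
pose ab : 'rV[R]_d * 'rV[R]_d := (\row_j - `|x ord0 j|, \row_j `|x ord0 j|).
apply: (@le_lt_trans _ _ (cbox_vol ab)%:E); last exact: ltry.
apply: ereal_inf_lbound; exists [set ab].
  split; first exact: countable1.
  move=> y xy; exists ab => // j; have := xy j; rewrite /= !mxE half_segmentE.
  have := ler_norm (x ord0 j); have := ler_norm (- x ord0 j); rewrite normrN.
  by case: ifP => _ ? ?; rewrite /= in_itv/= => /andP[? ?]; apply/andP; split; lra.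
by rewrite esum_set1//; exact: cbox_vol_ge0.
Qed.

Lemma lebesgue_outer_orthant_box_gt0 (R : realType) (d : nat) (hd : (1 <= d)%N)
    (w : d.-tuple bool) (x : 'rV[R]_d) :
  orthant w x -> (0 < lebesgue_outer (orthant_box R d w x))%E.
Proof.
move=> wx; apply: (@lt_le_trans _ _ (\prod_j `|x ord0 j|)%:E).
  rewrite lte_fin; apply: prodr_gt0 => j _; rewrite normr_gt0.
  by have := wx j; rewrite /orthant_factor; case: (tnth w j) => /= x0; apply/eqP; lra.
apply: lebesgue_outer_prodset_ge => // [|j|j].
- exists (\row_j (x ord0 j / 2)) => j; rewrite mxE; have := wx j.
  rewrite /orthant_factor /half_segment.
  by case: (tnth w j) => /= x0; split; lra.
- exact: measurable_half_segment.
- by rewrite lebesgue_measure_half_segment//; exact: wx.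
Qed.

(** The restriction of the outer measure to its Caratheodory sigma-algebra, on
    which it is a measure and therefore continuous from above. *)
Definition lebesgue_volume (R : realType) (d : nat) :
  set (caratheodory_type (@lebesgue_outer R d)) -> \bar R := @lebesgue_outer R d.

HB.instance Definition _ (R : realType) (d : nat) :=
  isMeasure.Build _ (caratheodory_type (@lebesgue_outer R d)) R
    (@lebesgue_volume R d)
    (caratheodory_measure0 (@lebesgue_outer R d))
    (@caratheodory_measure_ge0 _ _ (@lebesgue_outer R d))
    (@caratheodory_measure_sigma_additive _ _ (@lebesgue_outer R d)).

(** A large value f(x) forces f to be large on a fixed share of the box between 0
    and x: each y in it has, among the mixtures of y and x - y, one where f is
    large, and there is one mixture for each set of coordinates.  All these
    mixtures lie in the box of v, and the box of u is contained in the box of x,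
    so the share does not depend on x. *)
Lemma componentwise_subadditive_bounded (R : realType) (d : nat)
    (hd : (1 <= d)%N) (w : d.-tuple bool) (f : 'rV[R]_d -> R) (u v : 'rV[R]_d) :
  lebesgue_measurable_fun (orthant w) f ->
  componentwise_subadditive (orthant_factor w) f ->
  orthant w u -> orthant w v ->
  exists M : R, forall x, orthant w x -> orthant_prec w u x ->
    orthant_prec w x v -> f x <= M.
Proof.
move=> mf sf wu wv.
pose mu := lebesgue_volume R d.
pose A (n : nat) : set (caratheodory_type (@lebesgue_outer R d)) :=
  orthant_box R d w v `&` [set y | n%:R <= f y].
have mA n : measurable (A n).
  rewrite /A (_ : _ `&` _ =
      orthant_box R d w v `&` (orthant w `&` f @^-1` `[n%:R, +oo[%classic)).
    apply: measurableI.
      by apply: measurable_prodset => // j; exact: measurable_half_segment.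
    apply: mf; first exact: measurable_orthant.
    exact: measurable_itv.
  apply/seteqP; split=> y /=; rewrite in_itv/= andbT.
    by move=> [vy ny]; split=> //; split=> // j; have [] := vy j.
  by move=> [vy [_ ny]].
have A_cap : \bigcap_n A n = set0.
  rewrite -subset0 => y /(_ (Num.bound (f y)) I)[_ /=].
  rewrite leNgt (le_lt_trans (ler_norm _))//.
  exact: unstable.ltr_norm_bound.
have : mu \o A @ \oo --> mu (\bigcap_n A n).
  apply: nonincreasing_cvg_mu => //.
  - apply: le_lt_trans (lebesgue_outer_orthant_box_lty _ _ w v).
    by apply: le_lebesgue_outer => y [].
  - by rewrite A_cap; exact: measurable0.
  - move=> m n mn; apply/subsetPset => y [vy /= ny]; split=> //=.
    by apply: le_trans ny; rewrite ler_nat.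
have mu0 : mu set0 = 0%E := lebesgue_outer0 R d.
rewrite A_cap mu0 => A_cvg.
pose N := #|{set 'I_d}|.
have N0 : (0 < N)%N by apply/card_gt0P; exists finset.set0.
(* n is such that N copies of A n, one for each reflection, cannot cover the box
   of u. *)
have [n An] : exists n, (N%:R%:E * mu (A n) < mu (orthant_box R d w u))%E.
  apply: contrapT => noA.
  have := lebesgue_outer_orthant_box_gt0 R d hd w u wu; apply/negP; rewrite -leNgt.
  have -> : 0%E = lim (N%:R%:E * mu (A n) @[n --> \oo])%E.
    by apply/esym/cvg_lim => //; rewrite -(mule0 N%:R%:E); exact: cvgeZl.
  apply: lime_ge; first by apply: is_cvgeZl => //; apply/cvg_ex; exists 0%E.
  by apply: nearW => n; rewrite leNgt; apply/negP => An; apply: noA; exists n.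
exists (n%:R * \prod_(j < d) 2) => x wx ux xv.
have [y xy yA] : exists2 y, orthant_box R d w x y &
    forall b, ~ A n (reflect_coords R d b x y).
  apply: contrapT => noy.
  suff : (mu (orthant_box R d w u) <= N%:R%:E * mu (A n))%E by rewrite leNgt An.
  pose F k : set 'rV[R]_d :=
    reflect_coords R d (nth finset.set0 (enum {set 'I_d}) k) x @^-1` A n.
  have cover : orthant_box R d w u `<=` \big[setU/set0]_(k < N) F k.
    move=> y uy; rewrite -(bigcup_mkord N F).
    have xy : orthant_box R d w x y.
      move=> j; have := ux j; have := uy j; rewrite /half_segment.
      by case: (tnth w j) => /= -[? ?] ?; split; lra.
    apply: contrapT => yA; apply: noy; exists y => // b Ab; apply: yA.
    have bN : (index b (enum {set 'I_d}) < N)%N by rewrite /N cardE index_mem mem_enum.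
    by exists (index b (enum {set 'I_d})); rewrite //= /F nth_index// mem_enum.
  apply: le_trans (le_lebesgue_outer cover) _.
  apply: le_trans (outer_measure_subadditive (@lebesgue_outer R d) _ _) _.
  apply: le_trans (lee_sum _ (fun k _ => lebesgue_outer_reflect _ _ hd _ _ _)) _.
  by rewrite sumr_const card_ord mule_natl.
(* With multiplicities 1, the grid bound splits x as y + (x - y). *)
have := componentwise_subadditive_grid R d (orthant_factor w) f
  (fun j s t => half_line_add R (tnth w j) s t) sf y (x - y) (fun=> 1%N) n%:R.
have -> : \row_j (y ord0 j *+ 1 + (x - y) ord0 j) = x.
  by apply/rowP => j; rewrite !mxE mulr1n; ring.
have corner (z : 'rV[R]_d) :
    (forall j, z ord0 j = y ord0 j \/ z ord0 j = (x - y) ord0 j) -> f z <= n%:R.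
  move=> zy; rewrite leNgt; apply/negP => fz.
  apply: (yA [set j | z ord0 j != y ord0 j]%SET).
  have -> : reflect_coords R d [set j | z ord0 j != y ord0 j]%SET x y = z.
    apply/rowP => j; rewrite mxE inE; case: eqP => [->//|/= zj].
    by have [//|->] := zy j; rewrite !mxE.
  split=> /=; last exact: ltW.
  move=> j; have := xy j; have := xv j; rewrite /half_segment.
  by have [->|->] := zy j; rewrite ?mxE; case: (tnth w j) => /= ? -[? ?]; split; lra.
move=> /(_ _ _ corner) fx.
apply: le_trans (fx _ _) _.
- by move=> j; have [] := xy j.
- by move=> j; have [_] := xy j; rewrite !mxE.
rewrite big1// mulr1 mulrBr mulr1 addrCA gerDl subr_le0.
by apply: corner => j; left.
Qed.

(** * The Fekete estimate *)

Lemma bernoulli_le (R : realFieldType) (x : R) (n : nat) :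
  0 <= x -> x <= 1 -> 1 - x *+ n <= (1 - x) ^+ n.
Proof.
move=> x0 x1; elim: n => [|n IHn]; first by rewrite mulr0n subr0 expr0.
rewrite exprS mulrSr; apply: le_trans (ler_wpM2l _ IHn); last by rewrite subr_ge0.
have : 0 <= x * (x *+ n) by rewrite mulr_ge0// mulrn_wge0.
lra.
Qed.

Lemma orthant_prec_scale (R : realType) (d : nat) (w : d.-tuple bool)
    (x y : 'rV[R]_d) (rho : 'I_d -> R) :
  orthant w x -> (forall j, 1 <= rho j) ->
  (forall j, y ord0 j = x ord0 j * rho j) -> orthant w y /\ orthant_prec w x y.
Proof.
move=> wx rho1 yx; split=> j; rewrite yx; have := wx j; have := rho1 j;
  rewrite /orthant_factor; case: (tnth w j) => /= ? ?; nra.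
Qed.

Lemma orthant_neq0 (R : realType) (d : nat) (w : d.-tuple bool)
    (x : 'rV[R]_d) (j : 'I_d) : orthant w x -> x ord0 j != 0.
Proof.
move=> /(_ j); rewrite /orthant_factor.
by case: (tnth w j) => /= x0; apply/eqP => x00; rewrite x00 ltxx in x0.
Qed.

Lemma orthant_prod_norm_gt0 (R : realType) (d : nat) (w : d.-tuple bool)
    (x : 'rV[R]_d) : orthant w x -> 0 < \prod_j `|x ord0 j|.
Proof.
by move=> wx; apply: prodr_gt0 => j _; rewrite normr_gt0 (orthant_neq0 _ _ w).
Qed.

(** The Fekete estimate.  With q_j = x_j / u_j, the grid bound exceeds
    f(u) prod q_j by at most (M - f u) (prod q_j - prod n_j), and the second
    factor is a small fraction [eta] of prod q_j once all q_j are large, because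
    n_j >= q_j - 2. *)
Lemma fekete_orthant (R : realType) (d : nat) (hd : (1 <= d)%N)
    (w : d.-tuple bool) (f : 'rV[R]_d -> R) (u : 'rV[R]_d) (e : R) :
  lebesgue_measurable_fun (orthant w) f ->
  componentwise_subadditive (orthant_factor w) f ->
  orthant w u -> 0 < e ->
  exists2 x0, orthant w x0 & forall x, orthant w x -> orthant_prec w x0 x ->
    f x / \prod_j `|x ord0 j| <= f u / \prod_j `|u ord0 j| + e.
Proof.
move=> mf sf wu e0.
have [w2u u_2u] := orthant_prec_scale _ _ w u (\row_j (u ord0 j * 2))
  (fun=> 2) wu (fun=> ler1n _ 2%N) (fun j => mxE _ _ _ _).
have [M0 fM0] := componentwise_subadditive_bounded _ _ hd w f u _ mf sf wu w2u.
pose M := Num.max 0 M0.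
have M_ge0 : 0 <= M by rewrite le_max lexx.
have fM x : orthant w x -> orthant_prec w u x ->
    orthant_prec w x (\row_j (u ord0 j * 2)) -> f x <= M.
  by move=> *; rewrite le_max fM0 ?orbT.
have prec_refl : orthant_prec w u u by move=> j; case: ifP.
have fuM : f u <= M by exact: fM.
pose U := \prod_j `|u ord0 j|.
have U0 : 0 < U by exact: orthant_prod_norm_gt0.
(* eta makes (M - f u) * eta at most e * U; the + 1 avoids a zero denominator. *)
pose eta := e * U / (M - f u + 1).
have eta0 : 0 < eta by rewrite divr_gt0 ?mulr_gt0//; lra.
(* q_j >= 2 / delta gives n_j >= (1 - delta) q_j; by the Bernoulli inequality the
   product of the n_j then loses at most the fraction d * delta <= eta. *)
pose delta := Num.min 1 (eta / d%:R).
have d0 : 0 < d%:R :> R by rewrite ltr0n.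
have delta0 : 0 < delta by rewrite lt_min ltr01 divr_gt0.
have delta1 : delta <= 1 by rewrite ge_min lexx.
have d_delta : delta *+ d <= eta.
  by rewrite -mulr_natr -ler_pdivlMr// ge_min lexx orbT.
have delta_inv2 : 2 <= 2 / delta by rewrite ler_pdivlMr//; lra.
have [wx0 _] := orthant_prec_scale _ _ w u (\row_j (u ord0 j * (2 / delta)))
  (fun=> 2 / delta) wu (fun=> le_trans (ler1n _ 2%N) delta_inv2)
  (fun j => mxE _ _ _ _).
exists (\row_j (u ord0 j * (2 / delta))) => // x wx x0x.
pose q j := x ord0 j / u ord0 j.
have xE j : x ord0 j = u ord0 j * q j.
  by rewrite mulrC divfK// (orthant_neq0 _ _ w).
have q_ge j : 2 / delta <= q j.
  have := x0x j; rewrite mxE xE; have := wu j; rewrite /orthant_factor.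
  by case: (tnth w j) => /= uj; rewrite ?(ler_nM2l uj)// (ler_pM2l uj).
have q2 j : 2 <= q j by apply: le_trans (q_ge j).
(* One less than the integer part, so that the remainder is at least u_j and so
   stays away from the boundary of the orthant, near which f may be unbounded. *)
pose n j := (Num.trunc (q j)).-1.
have nE j : (n j).+1%:R <= q j < (n j).+1%:R + 1.
  have q0 : 0 <= q j by apply: le_trans (q2 j).
  have := truncn_itv q0; rewrite /n.
  case: (Num.trunc (q j)) => [|m]; last by rewrite -[m.+2%:R]natr1.
  by have := q2 j => ? /andP[_ ?]; lra.
pose r : 'rV[R]_d := \row_j (u ord0 j * (q j - (n j)%:R)).
have rho j : 1 <= q j - (n j)%:R <= 2.
  by have := nE j; rewrite -natr1 => /andP[? ?]; apply/andP; split; lra.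
have [wr u_r] : orthant w r /\ orthant_prec w u r.
  apply: (orthant_prec_scale _ _ w u r (fun j => q j - (n j)%:R)) => // j.
    by case/andP: (rho j).
  by rewrite mxE.
have r_2u : orthant_prec w r (\row_j (u ord0 j * 2)).
  move=> j; rewrite !mxE; have := wu j; have /andP[_] := rho j.
  rewrite /orthant_factor; case: (tnth w j) => /= ? ?; nra.
have corner (z : 'rV[R]_d) :
    (forall j, z ord0 j = u ord0 j \/ z ord0 j = r ord0 j) -> f z <= M.
  by move=> zur; apply: fM => j; have [->|->] := zur j; exact.
have := componentwise_subadditive_grid R d (orthant_factor w) f
  (fun j s t => half_line_add R (tnth w j) s t) sf u r n M wu wr corner.
have -> : \row_j (u ord0 j *+ n j + r ord0 j) = x.
  by apply/rowP => j; rewrite !mxE xE -mulr_natr; ring.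
set P := \prod_j (n j)%:R; set P1 := \prod_j (n j).+1%:R; pose Q := \prod_j q j.
have Q0 : 0 < Q by apply: prodr_gt0 => j _; apply: lt_le_trans (q2 j).
have P1_le : P1 <= Q.
  by apply: ler_prod => j _; case/andP: (nE j) => -> _; rewrite ler0n.
have P_ge : (1 - eta) * Q <= P.
  have : (1 - delta) ^+ d * Q <= P.
    rewrite -[X in _ ^+ X]card_ord -prodr_const -big_split/=.
    apply: ler_prod => j _; rewrite mulr_ge0 ?subr_ge0//=; last first.
      by apply: le_trans (q2 j).
    have := q_ge j; rewrite ler_pdivrMr// => ?.
    by have := nE j; rewrite -natr1 => /andP[? ?]; lra.
  apply: le_trans; rewrite ler_pM2r//.
  by apply: le_trans (bernoulli_le _ _ _ (ltW delta0) delta1); lra.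
have xQ : \prod_j `|x ord0 j| = U * Q.
  rewrite /U /Q -big_split/=; apply: eq_bigr => j _; rewrite xE normrM.
  by rewrite (ger0_norm (x := q j))// (le_trans _ (q2 j)).
rewrite xQ => fx.
rewrite ler_pdivrMr ?mulr_gt0//.
have -> : (f u / U + e) * (U * Q) = f u * Q + e * U * Q.
  by field; exact: lt0r_neq0.
apply: le_trans fx _.
have etaE : eta * (M - f u + 1) = e * U by rewrite divfK//; apply: lt0r_neq0; lra.
have : M * (P1 - P) <= M * (Q - P) by apply: ler_wpM2l => //; lra.
have : (M - f u) * (Q - P) <= (M - f u) * (eta * Q) by apply: ler_wpM2l; lra.
have : 0 <= eta * Q by rewrite mulr_ge0// ltW.
rewrite -etaE; lra.
Qed.

(** * Limits along directed sets *)

(** The two directed sets may differ: for a single directed set this is the usual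
    comparison of the two limits, and for two adjacent orthants it compares their
    limits. *)
Lemma dir_liminf_le_limsup (R : realType) (T : Type)
    (U U' : set T) (prec prec' : T -> T -> Prop) (g : T -> \bar R) :
  (forall x' x, U' x' -> U x -> exists z' z,
    [/\ U' z', prec' x' z', U z, prec x z & (g z' <= g z)%E]) ->
  (dir_liminf U' prec' g <= dir_limsup U prec g)%E.
Proof.
move=> cofinal; apply: ge_ereal_sup => _ [x' Ux' <-].
apply: le_ereal_inf_tmp => _ [x Ux <-].
have [z' [z [Uz' xz' Uz xz]]] := cofinal _ _ Ux' Ux.
move=> gz; apply: le_trans (ereal_inf_lbound _) _; first by exists z'.
by apply: le_trans gz _; apply: ereal_sup_ubound; exists z.
Qed.

(** Fekete in abstract form: if the values are eventually almost below each single
    value, then the upper limit is at most the infimum, which is always below the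
    lower limit. *)
Lemma has_dir_lim_inf (R : realType) (T : Type) (U : set T)
    (prec : T -> T -> Prop) (g : T -> \bar R) :
  U !=set0 ->
  (forall x y, U x -> U y -> exists z, [/\ U z, prec x z & prec y z]) ->
  (forall u e, U u -> 0 < e -> exists2 x0, U x0 &
    forall x, U x -> prec x0 x -> (g x <= g u + e%:E)%E) ->
  has_dir_lim U prec g (ereal_inf [set g x | x in U]).
Proof.
move=> [p Up] directed almost_inf.
have inf_le : (ereal_inf [set g x | x in U] <= dir_liminf U prec g)%E.
  apply: le_trans (ereal_sup_ubound _); last by exists p.
  by apply: ereal_inf_le_tmp => _ [x [Ux _] <-]; exists x.
have le_inf : (dir_limsup U prec g <= ereal_inf [set g x | x in U])%E.
  apply: le_ereal_inf_tmp => _ [u Uu <-]; apply/lee_addgt0Pr => e e0.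
  have [x0 Ux0 gx0] := almost_inf u e Uu e0.
  apply: le_trans (ereal_inf_lbound _) _; first by exists x0.
  by apply: ge_ereal_sup => _ [x [Ux x0x] <-]; exact: gx0.
have inf_le_sup : (dir_liminf U prec g <= dir_limsup U prec g)%E.
  apply: dir_liminf_le_limsup => x y Ux Uy.
  by have [z [Uz xz yz]] := directed _ _ Ux Uy; exists z, z.
split; apply/eqP; rewrite eq_le.
  by rewrite inf_le (le_trans inf_le_sup).
by rewrite le_inf (le_trans inf_le).
Qed.

Lemma has_dir_limN (R : realType) (T : Type) (U : set T)
    (prec : T -> T -> Prop) (g : T -> \bar R) (l : \bar R) :
  has_dir_lim U prec g l -> has_dir_lim U prec (fun x => - g x)%E (- l)%E.
Proof.
move=> [infl supl]; split.
  rewrite -supl /dir_limsup -ereal_supN image_comp; congr ereal_sup.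
  by apply: eq_imagel => x _ /=; rewrite -ereal_infN image_comp.
rewrite -infl /dir_liminf -ereal_infN image_comp; congr ereal_inf.
by apply: eq_imagel => x _ /=; rewrite -ereal_supN image_comp.
Qed.

(** * Limits in one orthant *)

Definition orthant_point (R : realType) (d : nat) (w : d.-tuple bool) (K : R) :
  'rV[R]_d := \row_j ((-1) ^+ tnth w j * K).

Lemma orthant_pointP (R : realType) (d : nat) (w : d.-tuple bool) (K : R) :
  0 < K -> orthant w (orthant_point R d w K).
Proof.
move=> K0 j; rewrite mxE /orthant_factor.
by case: (tnth w j) => /=; rewrite ?expr1 ?expr0; lra.
Qed.

Lemma orthant_add (R : realType) (d : nat) (w : d.-tuple bool)
    (x y : 'rV[R]_d) : orthant w x -> orthant w y ->
  [/\ orthant w (x + y), orthant_prec w x (x + y) & orthant_prec w y (x + y)].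
Proof.
move=> wx wy; split=> j; rewrite mxE; have := wx j; have := wy j;
  rewrite /orthant_factor; case: (tnth w j) => /=; lra.
Qed.

Lemma sign_ones (R : realType) (d : nat) (w : d.-tuple bool) :
  (-1) ^+ ones w = \prod_j (-1) ^+ tnth w j :> R.
Proof.
rewrite /ones -sum1_count big_tuple (big_morph _ (exprD _) (expr0 _)) big_mkcond.
by apply: eq_bigr => j _; case: (tnth w j).
Qed.

Lemma orthant_prodE (R : realType) (d : nat) (w : d.-tuple bool)
    (x : 'rV[R]_d) : orthant w x ->
  \prod_j x ord0 j = (-1) ^+ ones w * \prod_j `|x ord0 j|.
Proof.
move=> wx; rewrite sign_ones -big_split/=; apply: eq_bigr => j _.
have := wx j; rewrite /orthant_factor; case: (tnth w j) => /= xj.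
  by rewrite expr1 mulN1r ltr0_norm// opprK.
by rewrite expr0 mul1r gtr0_norm.
Qed.

(** The odd and even cases differ only by this sign. *)
Lemma normalized_orthant (R : realType) (d : nat) (w : d.-tuple bool)
    (f : 'rV[R]_d -> R) (x : 'rV[R]_d) : orthant w x ->
  normalized f x = ((-1) ^+ odd (ones w) * (f x / \prod_j `|x ord0 j|))%:E.
Proof.
move=> wx; rewrite /normalized (orthant_prodE _ _ w)// invfM signr_odd.
by rewrite invr_sign mulrCA.
Qed.

Lemma orthant_lim_abs (R : realType) (d : nat) (hd : (1 <= d)%N)
    (w : d.-tuple bool) (f : 'rV[R]_d -> R) (g : 'rV[R]_d -> \bar R) :
  lebesgue_measurable_fun (orthant w) f ->
  componentwise_subadditive (orthant_factor w) f ->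
  (forall x, orthant w x -> g x = (f x / \prod_j `|x ord0 j|)%:E) ->
  orthant_lim w g (ereal_inf [set g x | x in orthant w]).
Proof.
move=> mf sf gE; apply: has_dir_lim_inf => [|x y wx wy|u e wu e0].
- by exists (orthant_point R d w 1); exact: orthant_pointP.
- by exists (x + y); apply/orthant_add.
- have [x0 wx0 fx0] := fekete_orthant _ _ hd w f u e mf sf wu e0.
  by exists x0 => // x wx x0x; rewrite !gE// -EFinD lee_fin fx0.
Qed.

Lemma orthant_lim_even (R : realType) (d : nat) (hd : (1 <= d)%N)
    (w : d.-tuple bool) (f : 'rV[R]_d -> R) :
  ~~ odd (ones w) ->
  lebesgue_measurable_fun (orthant w) f ->
  componentwise_subadditive (orthant_factor w) f ->
  let m := ereal_inf [set normalized f x | x in orthant w] in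
  orthant_lim w (normalized f) m /\ m != +oo%E.
Proof.
move=> even mf sf m; split.
  apply: (orthant_lim_abs _ _ hd w f) => // x wx.
  by rewrite (normalized_orthant _ _ w)// (negbTE even) expr0 mul1r.
rewrite -ltey; apply: le_lt_trans (ereal_inf_lbound _) (ltry _); last first.
  by exists (orthant_point R d w 1); [exact: orthant_pointP|reflexivity].
Qed.

Lemma orthant_lim_odd (R : realType) (d : nat) (hd : (1 <= d)%N)
    (w : d.-tuple bool) (f : 'rV[R]_d -> R) :
  odd (ones w) ->
  lebesgue_measurable_fun (orthant w) f ->
  componentwise_subadditive (orthant_factor w) f ->
  let m := ereal_sup [set normalized f x | x in orthant w] in
  orthant_lim w (normalized f) m /\ m != -oo%E.
Proof.
move=> odd_w mf sf m; split.
  have -> : normalized f = (fun x => - - normalized f x)%E.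
    by apply/funext => x; rewrite oppeK.
  have -> : m = (- ereal_inf [set - normalized f x | x in orthant w])%E.
    by rewrite -(image_comp (normalized f) -%E) ereal_infN oppeK.
  apply: has_dir_limN; apply: (orthant_lim_abs _ _ hd w f) => // x wx.
  by rewrite (normalized_orthant _ _ w)// odd_w expr1 mulN1r EFinN oppeK.
rewrite -ltNye; apply: lt_le_trans (ltNyr _) (ereal_sup_ubound _).
by exists (orthant_point R d w 1); [exact: orthant_pointP|reflexivity].
Qed.

(** * Infinite limits *)

(** A witness for infinite limits: in each coordinate it is -c t^2 with c >= 0,
    which is subadditive where s t >= 0, and its quotient by prod x_j is
    - prod x_j, which is unbounded. *)
Definition neg_prod_sq (R : realType) (d : nat) (x : 'rV[R]_d) : R :=
  - \prod_j x ord0 j ^+ 2.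

Lemma measurable_neg_prod_sq (R : realType) (d : nat) (hd : (1 <= d)%N)
    (D : set 'rV[R]_d) : lebesgue_measurable_fun D (neg_prod_sq R d).
Proof.
apply: measurableT_comp; first exact: oppr_measurable.
apply: measurable_prod => j _.
by apply: measurable_funX; exact: measurable_coord.
Qed.

Lemma neg_prod_sq_subadditive (R : realType) (d : nat) (w : d.-tuple bool) :
  componentwise_subadditive (orthant_factor w) (neg_prod_sq R d).
Proof.
move=> i x _ s t; rewrite /orthant_factor => ws wt.
have fE r : neg_prod_sq R d (subst_coord x i r) =
    - (r ^+ 2 * \prod_(j | j != i) x ord0 j ^+ 2).
  rewrite /neg_prod_sq (bigD1 i)//= mxE eqxx; congr (- (_ * _)).
  by apply: eq_bigr => j ji; rewrite mxE (negbTE ji).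
rewrite !fE -opprD lerN2 -mulrDl ler_wpM2r//.
  by apply: prodr_ge0 => j _; exact: sqr_ge0.
by move: ws wt; case: (tnth w i) => /=; nra.
Qed.

Lemma normalized_neg_prod_sq (R : realType) (d : nat) (hd : (1 <= d)%N)
    (w : d.-tuple bool) (K : R) : 1 <= K ->
  exists2 x, orthant w x &
    exists2 L, K <= L & normalized (neg_prod_sq R d) x =
      (- ((-1) ^+ odd (ones w) * L))%:E.
Proof.
move=> K1; have wx := orthant_pointP R d w K (lt_le_trans ltr01 K1).
exists (orthant_point R d w K) => //; exists (K ^+ d).
  by rewrite -[leLHS]expr1 ler_weXn2l.
have norm_x j : `|orthant_point R d w K ord0 j| = K.
  by rewrite mxE normrMsign ger0_norm// (le_trans ler01).
rewrite (normalized_orthant _ _ w)// /neg_prod_sq.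
under [\prod_j _ ^+ 2]eq_bigr do rewrite -real_normK ?num_real// norm_x.
under [\prod_j `|_|]eq_bigr do rewrite norm_x.
rewrite !prodr_const card_ord -mulrN -exprM mulnC exprM expr2 mulNr mulfK//.
by rewrite expf_neq0// gt_eqF// (lt_le_trans ltr01).
Qed.

(** * Adjacent orthants *)

Lemma differ_exactly_at_odd (R : realType) (d : nat) (w w' : d.-tuple bool)
    (i : 'I_d) : differ_exactly_at w w' i -> odd (ones w') = ~~ odd (ones w).
Proof.
move=> [wi wj]; have : (-1) ^+ ones w' = - (-1) ^+ ones w :> R.
  rewrite !sign_ones !(bigD1 (P := predT) i)//= -mulNr; congr (_ * _).
    by case: (tnth w' i) (tnth w i) wi => -[]//= _; rewrite ?opprK.
  by apply: eq_bigr => j ji; rewrite wj.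
rewrite -(signr_odd _ (ones w)) -(signr_odd _ (ones w')).
case: (odd (ones w)) (odd (ones w')) => -[]//=; rewrite ?expr1 ?expr0; lra.
Qed.

(** The value on the boundary hyperplane is nonnegative, since 0 + 0 = 0 in the
    i-th semigroup, and it is at most the sum, since x_i + (- x_i) = 0. *)
Lemma glued_opposite_sum_ge0 (R : realType) (d : nat) (w : d.-tuple bool)
    (i : 'I_d) (f : 'rV[R]_d -> R) (x : 'rV[R]_d) :
  componentwise_subadditive (glued_factor w i) f -> orthant w x ->
  0 <= f x + f (subst_coord x i (- x ord0 i)).
Proof.
move=> sf wx.
have xS j : j != i -> glued_factor w i j (x ord0 j).
  by move=> ji; rewrite /glued_factor (negbTE ji); exact: wx.
have Si (t : R) : glued_factor w i i t by rewrite /glued_factor eqxx.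
have := sf i x xS _ _ (Si (x ord0 i)) (Si (- x ord0 i)).
have := sf i x xS _ _ (Si 0) (Si 0).
have -> : subst_coord x i (x ord0 i) = x.
  by apply/rowP => j; rewrite mxE; case: eqP => [->|].
rewrite addr0 subrr; lra.
Qed.

(** Each point of the second orthant is the mirror image of a point of the first,
    and the quotient does not increase under the mirror; so the lower limit in
    the second orthant is at most the upper limit in the first. *)
Lemma glued_orthant_lims (R : realType) (d : nat) (hd : (1 <= d)%N)
    (w w' : d.-tuple bool) (i : 'I_d) (f : 'rV[R]_d -> R) :
  ~~ odd (ones w) -> differ_exactly_at w w' i ->
  lebesgue_measurable_fun (glued_orthants w w' i) f ->
  componentwise_subadditive (glued_factor w i) f ->
  exists l l' : \bar R,
    [/\ orthant_lim w (normalized f) l, orthant_lim w' (normalized f) l',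
        (l' <= l)%E, l \is a fin_num & l' \is a fin_num].
Proof.
move=> even ww' mf sf; have [wi wj] := ww'.
have odd' : odd (ones w') by rewrite (differ_exactly_at_odd R _ _ _ _ ww').
have restrict v : (forall j, j != i -> tnth v j = tnth w j) ->
    lebesgue_measurable_fun (orthant v) f /\
    componentwise_subadditive (orthant_factor v) f.
  move=> vw; split.
    apply: measurable_funS mf.
      rewrite (glued_orthantsE _ ww').
      apply: measurable_prodset => // j; rewrite /glued_factor.
      by case: ifP => _; [exact: measurableT|exact: measurable_half_line].
    rewrite (glued_orthantsE _ ww') => x vx j; rewrite /glued_factor.
    case: ifPn => // ji; rewrite /orthant_factor -vw//; exact: vx.
  have sub j : orthant_factor v j `<=` glued_factor w i j.
    by rewrite /glued_factor /orthant_factor; case: ifPn => // ji; rewrite vw.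
  move=> k x vx s t vs vt; apply: (sf k) => [j jk||]; apply: sub => //.
  exact: vx.
have [mw sw] := restrict w (fun _ _ => erefl).
have [mw' sw'] := restrict w' wj.
have [lim_w w_lty] := orthant_lim_even R d hd w f even mw sw.
have [lim_w' w'_gty] := orthant_lim_odd R d hd w' f odd' mw' sw'.
set l := ereal_inf _ in lim_w w_lty; set l' := ereal_sup _ in lim_w' w'_gty.
have l'l : (l' <= l)%E.
  have [<- _] := lim_w'; have [_ <-] := lim_w.
  apply: dir_liminf_le_limsup => x' x wx' wx.
  pose y : 'rV[R]_d := subst_coord x' i (- x' ord0 i).
  have wy : orthant w y.
    move=> j; rewrite mxE; have := wx' j; rewrite /orthant_factor.
    case: eqP => [->|/eqP ji]; last by rewrite wj.
    by case: (tnth w i) (tnth w' i) wi => -[]//= _; lra.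
  (* z is beyond both x and the mirror image of x', and its mirror image is
     beyond x'. *)
  have [wz xz yz] := orthant_add R d w x y wx wy.
  pose z := x + y; pose z' : 'rV[R]_d := subst_coord z i (- z ord0 i).
  have wz' : orthant w' z'.
    move=> j; rewrite mxE; have := wz j; rewrite /orthant_factor -/z.
    case: eqP => [->|/eqP ji]; last by rewrite wj.
    by case: (tnth w i) (tnth w' i) wi => -[]//= _; lra.
  exists z', z; split=> //.
    move=> j; rewrite mxE; have := yz j; rewrite /y !mxE.
    case: eqP => [->|/eqP ji]; last by rewrite wj.
    rewrite eqxx.
    by case: (tnth w i) (tnth w' i) wi => -[]//= _; lra.
  rewrite /normalized lee_fin.
  have -> : \prod_j z' ord0 j = - \prod_j z ord0 j.
    rewrite !(bigD1 (P := predT) i)//= mxE eqxx mulNr; congr (- (_ * _)).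
    by apply: eq_bigr => j ji; rewrite mxE (negbTE ji).
  have z0 : 0 < \prod_j z ord0 j.
    rewrite (orthant_prodE _ _ w)// -signr_odd (negbTE even) mul1r.
    exact: orthant_prod_norm_gt0.
  rewrite invrN mulrN -mulNr ler_pM2r ?invr_gt0//.
  by have := glued_opposite_sum_ge0 R d w i f z sf wz; rewrite -/z'; lra.
have l_fin : l \is a fin_num.
  by rewrite fin_numE w_lty andbT -ltNye (lt_le_trans _ l'l)// ltNye.
have l'_fin : l' \is a fin_num.
  by rewrite fin_numE w'_gty -ltey (le_lt_trans l'l)// ltey.
by exists l, l'.
Qed.

Theorem theorem5p3 (R : realType) (d : nat) (hd : (1 <= d)%N)
    (w w' : d.-tuple bool) :
  (~~ odd (ones w) ->
    (forall f : 'rV[R]_d -> R,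
      lebesgue_measurable_fun (orthant w) f ->
      componentwise_subadditive (orthant_factor w) f ->
      let m := ereal_inf [set normalized f x | x in orthant w] in
      orthant_lim w (normalized f) m /\ m != +oo%E) /\
    (exists f : 'rV[R]_d -> R,
      [/\ lebesgue_measurable_fun (orthant w) f,
          componentwise_subadditive (orthant_factor w) f &
          orthant_lim w (normalized f) -oo%E])) /\
  (odd (ones w) ->
    (forall f : 'rV[R]_d -> R,
      lebesgue_measurable_fun (orthant w) f ->
      componentwise_subadditive (orthant_factor w) f ->
      let m := ereal_sup [set normalized f x | x in orthant w] in
      orthant_lim w (normalized f) m /\ m != -oo%E) /\
    (exists f : 'rV[R]_d -> R,
      [/\ lebesgue_measurable_fun (orthant w) f,
          componentwise_subadditive (orthant_factor w) f &
          orthant_lim w (normalized f) +oo%E])) /\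
  (forall i : 'I_d, ~~ odd (ones w) -> differ_exactly_at w w' i ->
    forall f : 'rV[R]_d -> R,
      lebesgue_measurable_fun (glued_orthants w w' i) f ->
      componentwise_subadditive (glued_factor w i) f ->
      exists l l' : \bar R,
        [/\ orthant_lim w (normalized f) l,
            orthant_lim w' (normalized f) l',
            (l' <= l)%E,
            l \is a fin_num &
            l' \is a fin_num]).
Proof.
have mP := measurable_neg_prod_sq R d hd (orthant w).
have sP := neg_prod_sq_subadditive R d w.
split; [|split].
- move=> even; split; first by move=> f; exact: orthant_lim_even.
  exists (neg_prod_sq R d); split=> //.
  have [+ _] := orthant_lim_even R d hd w _ even mP sP.
  suff -> : ereal_inf [set normalized (neg_prod_sq R d) x | x in orthant w] =
    -oo%E by [].
  apply: eq_ninfty => A.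
  have K1 : 1 <= Num.max 1 (- A) by rewrite le_max lexx.
  have [x wx [L KL fx]] := normalized_neg_prod_sq R d hd w _ K1.
  apply: le_trans (ereal_inf_lbound _) _; first by exists x.
  have : - A <= L by apply: le_trans KL; rewrite le_max lexx orbT.
  by rewrite fx (negbTE even) expr0 mul1r lee_fin; lra.
- move=> odd_w; split; first by move=> f; exact: orthant_lim_odd.
  exists (neg_prod_sq R d); split=> //.
  have [+ _] := orthant_lim_odd R d hd w _ odd_w mP sP.
  suff -> : ereal_sup [set normalized (neg_prod_sq R d) x | x in orthant w] =
    +oo%E by [].
  apply: eq_infty => A.
  have K1 : 1 <= Num.max 1 A by rewrite le_max lexx.
  have [x wx [L KL fx]] := normalized_neg_prod_sq R d hd w _ K1.
  apply: le_trans (ereal_sup_ubound _); last by exists x.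
  have : A <= L by apply: le_trans KL; rewrite le_max lexx orbT.
  by rewrite fx odd_w expr1 mulN1r opprK lee_fin.
- by move=> i even ww' f mf sf; exact: (glued_orthant_lims _ _ hd w w' i).
Qed.
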